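(* The derivative of the lower incomplete gamma function $\gamma(\nu,x)$ with respect to its parameter $\nu$ is $$\frac{\partial\gamma(\nu,x)}{\partial\nu}=\gamma(\nu,x)\ln x-\frac{x^\nu}{\nu^2}\;{}_2F_2\!\left(\left.\begin{array}{c}\nu,\nu\\ \nu+1,\nu+1\end{array}\right|-x\right).$$
   Context: The lower incomplete gamma function is defined as $\gamma(\nu,x)=\int_0^xt^{\nu-1}e^{-t}\,dt$; it has the series expansion $\gamma(\nu,x)=e^{-x}\sum_{k=0}^{\infty}\frac{x^{k+\nu}}{(\nu)_{k+1}}$, where $(\nu)_k=\Gamma(\nu+k)/\Gamma(\nu)$ is the Pochhammer symbol. ${}_2F_2$ is the generalized hypergeometric function. *)

(* Defs.v *)
From Stdlib Require Export Reals Factorial.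
From Coquelicot Require Export Coquelicot.

Open Scope R_scope.

Definition Cexp (z : C) : C := (exp (Re z) * cos (Im z), exp (Re z) * sin (Im z)).

(* Principal argument, with values in (-PI, PI]; unspecified at z = 0. *)
Definition Carg (z : C) : R :=
  if Rle_dec 0 (Im z) then acos (Re z / Cmod z) else - acos (Re z / Cmod z).

Definition Clog (z : C) : C := (ln (Cmod z), Carg z).

(* Principal value of z^w for z <> 0; Coquelicot's Cpow has exponents in nat. *)
Definition Cpower (z w : C) : C := Cexp (w * Clog z)%C.

Definition CSeries (a : nat -> C) : C :=
  iota (T := C_CompleteNormedModule) (is_series a).

(* Improper integral of a complex-valued function of a real variable. *)
Definition CRInt_gen (f : R -> C) (Fa Fb : (R -> Prop) -> Prop) : C :=
  RInt_gen (V := C_R_CompleteNormedModule) f Fa Fb.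

(* Integral of f along the straight segment from a to b, as an improper integral
   at the endpoint a, where f may be singular. *)
Definition Csegment_int (f : C -> C) (a b : C) : C :=
  CRInt_gen (fun s : R => ((b - a) * f (a + RtoC s * (b - a)))%C)
    (at_right 0) (at_point 1).

(* Meaningful for 0 < Re nu, where the integral converges at 0. *)
Definition lower_gamma (nu x : C) : C :=
  Csegment_int (fun t : C => (Cpower t (nu - 1) * Cexp (- t))%C) 0%C x.

(* Euler's integral, meaningful for 0 < Re z. *)
Definition CGamma (z : C) : C :=
  CRInt_gen (fun t : R => (Cpower (RtoC t) (z - 1) * Cexp (- RtoC t))%C)
    (at_right 0) (Rbar_locally p_infty).

Definition Cpochhammer (a : C) (k : nat) : C :=
  (CGamma (a + RtoC (INR k)) / CGamma a)%C.

(* As CGamma, it is meaningful for parameters with positive real part. *)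
Definition hyp2F2 (a1 a2 b1 b2 z : C) : C :=
  CSeries (fun k : nat =>
    (Cpochhammer a1 k * Cpochhammer a2 k / (Cpochhammer b1 k * Cpochhammer b2 k)
     * (z ^ k / RtoC (INR (fact k))))%C).

(* Main.v *)
(* With P(mu) = sum_k (-x)^k / (k! (mu + k)), term-by-term integration gives
   lower_gamma mu x = x^mu P(mu): s^mu sum_k (-x s)^k / (k! (mu + k)) is the primitive of
   s^(mu-1) e^(-xs) vanishing at 0. Differentiating the product in mu yields the logarithmic
   term and -x^nu sum_k (-x)^k / (k! (nu + k)^2). Since Gamma(z + 1) = z Gamma(z), the ratio
   (nu)_k / (nu + 1)_k is nu / (nu + k), which identifies this sum with the 2F2 series. The
   Pochhammer symbols being quotients of gamma values, this needs Gamma to have no zero in the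
   right half-plane; by the functional equation it suffices to exclude zeros far to the right. *)

Require Import Defs.
From Stdlib Require Import Lra Lia Psatz.

(** * Complex exponential and logarithm *)

(** No sum is ever exchanged with an integral: the primitive is written down as a series and
    differentiated, and the fundamental theorem of calculus does the rest. The substitution t = s x
    turns the segment into a real interval, so every integral is that of a C-valued function of a
    real variable; only the parameter is a complex variable. The same primitive with x = 1 serves
    Euler's integral: it settles the endpoint 0, and only the limit at infinity needs a separate
    estimate. The derivative in mu rests on explicit quadratic remainder bounds, uniform in the
    summation index, rather than on theorems about holomorphic functions. Non-vanishing of Gamma
    uses neither a product nor a reflection formula: a zero far to the right would give a
    nonnegative function a negative integral. *)

Lemma C_eq (a b : C) : Re a = Re b -> Im a = Im b -> a = b.
Proof. destruct a, b; simpl; intros -> ->; reflexivity. Qed.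

Lemma filterlim_C {T : Type} (F : (T -> Prop) -> Prop) {FF : Filter F}
  (f : T -> C) (l : C) :
  filterlim f F (locally l) <->
  filterlim (fun t => Re (f t)) F (locally (Re l)) /\
  filterlim (fun t => Im (f t)) F (locally (Im l)).
Proof.
  split.
  - intros H; split; apply filterlim_locally; intros eps;
      generalize (proj1 (filterlim_locally (U := C_UniformSpace) f l) H eps);
      apply filter_imp; intros t [H1 H2]; assumption.
  - intros [H1 H2]. apply (filterlim_locally (U := C_UniformSpace)); intros eps.
    generalize (filter_and _ _ (proj1 (filterlim_locally _ _) H1 eps)
                  (proj1 (filterlim_locally _ _) H2 eps)).
    apply filter_imp; intros t [h1 h2]; split; assumption.
Qed.

Lemma is_derive_RC (f : R -> C) (t : R) (l : C) :
  is_derive (V := C_R_NormedModule) f t l <->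
  is_derive (fun s => Re (f s)) t (Re l) /\ is_derive (fun s => Im (f s)) t (Im l).
Proof.
  split.
  - intros H. split.
    + apply (filterdiff_comp' f (fun z : C_R_NormedModule => fst z) t _ (fun z => fst z) H).
      apply filterdiff_linear, (is_linear_fst (U := R_NormedModule) (V := R_NormedModule)).
    + apply (filterdiff_comp' f (fun z : C_R_NormedModule => snd z) t _ (fun z => snd z) H).
      apply filterdiff_linear, (is_linear_snd (U := R_NormedModule) (V := R_NormedModule)).
  - intros [H1 H2].
    (* Split [f] along the basis (1, 0), (0, 1): each summand is a real function times a fixed
       vector. *)
    apply (is_derive_ext (V := C_R_NormedModule)
      (fun s => plus (scal (Re (f s)) (1, 0) : C_R_NormedModule) (scal (Im (f s)) (0, 1)))).
    { intros s. apply C_eq; cbn; unfold mult; simpl; ring. }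
    replace l with (plus (scal (Re l) (1, 0) : C_R_NormedModule) (scal (Im l) (0, 1))).
    2:{ apply C_eq; cbn; unfold mult; simpl; ring. }
    apply (is_derive_plus (V := C_R_NormedModule));
      apply (is_derive_scal_l (V := C_R_NormedModule)); assumption.
Qed.

Lemma is_derive_RC_mult (f g : R -> C) (t : R) (df dg : C) :
  is_derive (V := C_R_NormedModule) f t df ->
  is_derive (V := C_R_NormedModule) g t dg ->
  is_derive (V := C_R_NormedModule) (fun s => (f s * g s)%C) t (df * g t + f t * dg)%C.
Proof.
  assert (HR : forall (u v : R -> R) (du dv : R), is_derive u t du -> is_derive v t dv ->
    is_derive (fun s => u s * v s) t (du * v t + u t * dv)).
  { intros u v du dv Hu Hv. auto_derive.
    - repeat split; eexists; eassumption.
    - replace (Derive (fun x => u x) t) with du by (symmetry; apply is_derive_unique, Hu).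
      replace (Derive (fun x => v x) t) with dv by (symmetry; apply is_derive_unique, Hv).
      ring. }
  rewrite !is_derive_RC. intros [Hf1 Hf2] [Hg1 Hg2]. split.
  - replace (Re _) with ((Re df * Re (g t) + Re (f t) * Re dg)
      - (Im df * Im (g t) + Im (f t) * Im dg)) by (simpl; unfold Re, Im; ring).
    exact (is_derive_minus _ _ _ _ _ (HR _ _ _ _ Hf1 Hg1) (HR _ _ _ _ Hf2 Hg2)).
  - replace (Im _) with ((Re df * Im (g t) + Re (f t) * Im dg)
      + (Im df * Re (g t) + Im (f t) * Re dg)) by (simpl; unfold Re, Im; ring).
    exact (is_derive_plus _ _ _ _ _ (HR _ _ _ _ Hf1 Hg2) (HR _ _ _ _ Hf2 Hg1)).
Qed.

Lemma Cexp_plus (a b : C) : Cexp (a + b) = (Cexp a * Cexp b)%C.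
Proof.
  destruct a, b; unfold Cexp; apply C_eq; simpl; rewrite exp_plus, ?cos_plus, ?sin_plus; ring.
Qed.

Lemma Cexp_0 : Cexp 0 = 1%C.
Proof. unfold Cexp; simpl. rewrite exp_0, cos_0, sin_0, Rmult_1_r, Rmult_0_r. reflexivity. Qed.

Lemma Cmod_Cexp (z : C) : Cmod (Cexp z) = exp (Re z).
Proof.
  unfold Cmod, Cexp; simpl.
  replace (_ + _) with (Rsqr (exp (Re z))).
  - apply sqrt_Rsqr. left; apply exp_pos.
  - assert (H := sin2_cos2 (Im z)). unfold Rsqr in *.
    transitivity (exp (Re z) * exp (Re z) * (sin (Im z) * sin (Im z) + cos (Im z) * cos (Im z)));
      [rewrite H|]; ring.
Qed.

Lemma Cexp_opp (z : C) : (Cexp (- z) * Cexp z)%C = 1%C.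
Proof. rewrite <- Cexp_plus, <- Cexp_0. f_equal. ring. Qed.

(** A general inner [f] covers both factors of the gamma integrand: [f] = [ln] gives the complex
    powers of t, the identity gives the exponential. *)
Lemma is_derive_RC_Cexp (z : C) (f : R -> R) (t df : R) :
  is_derive f t df ->
  is_derive (V := C_R_NormedModule) (fun s => Cexp (z * RtoC (f s))) t
    (z * RtoC df * Cexp (z * RtoC (f t)))%C.
Proof.
  intros H.
  assert (E : Derive (fun s => f s) t = df) by (apply is_derive_unique, H).
  apply is_derive_RC; unfold Cexp; destruct z as [a b]; simpl; split; auto_derive;
    try (repeat split; eexists; eassumption).
  all: rewrite E; change (a * f t + - (b * 0)) with (a * f t - b * 0); ring.
Qed.

Lemma Clog_pos (t : R) : 0 < t -> Clog (RtoC t) = RtoC (ln t).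
Proof.
  intros Ht. unfold Clog, Carg.
  rewrite Cmod_R, Rabs_pos_eq by lra. simpl.
  destruct (Rle_dec 0 0); [|lra].
  replace (t / t) with 1 by (field; lra). rewrite acos_1. reflexivity.
Qed.

(** The sine of the arccosine only yields the absolute value of the imaginary part; the case split
    in [Carg] restores its sign. *)
Lemma Cexp_Clog (x : C) : x <> 0%C -> Cexp (Clog x) = x.
Proof.
  intros Hx. apply Cmod_gt_0 in Hx.
  unfold Cexp, Clog. simpl Re. simpl Im. rewrite exp_ln by assumption.
  assert (Hr := re_le_Cmod x). apply Rabs_le_between in Hr.
  assert (Hc : -1 <= Re x / Cmod x <= 1).
  { split; [apply Rle_div_r | apply Rle_div_l]; lra. }
  assert (Hs : Cmod x * sin (acos (Re x / Cmod x)) = Rabs (Im x)).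
  { rewrite sin_acos by assumption.
    rewrite <- (sqrt_Rsqr_abs (Im x)).
    rewrite <- (sqrt_Rsqr (Cmod x)) at 1 by lra.
    rewrite <- sqrt_mult_alt by apply Rle_0_sqr. f_equal.
    assert (H2 := Cmod2_alt x). unfold Rsqr.
    replace (Im x * Im x) with (Cmod x ^ 2 - Re x ^ 2) by lra. field. lra. }
  unfold Carg. destruct (Rle_dec 0 (Im x)) as [h|h].
  - apply C_eq; simpl.
    + rewrite cos_acos by assumption. field. lra.
    + rewrite Hs, Rabs_pos_eq; auto.
  - apply C_eq; simpl.
    + rewrite cos_neg, cos_acos by assumption. field. lra.
    + rewrite sin_neg, Ropp_mult_distr_r_reverse, Hs, Rabs_left; [ring|lra].
Qed.

(** * Power series with complex coefficients *)

Lemma sum_n_C (a : nat -> C) (n : nat) :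
  sum_n (G := C_NormedModule) a n = (sum_n (fun k => Re (a k)) n, sum_n (fun k => Im (a k)) n).
Proof.
  induction n as [|n IH].
  - rewrite !sum_O. destruct (a 0%nat); reflexivity.
  - rewrite !sum_Sn, IH. reflexivity.
Qed.

Lemma is_series_C (a : nat -> C) (l : C) :
  is_series (V := C_NormedModule) a l <->
  is_series (fun k => Re (a k)) (Re l) /\ is_series (fun k => Im (a k)) (Im l).
Proof.
  unfold is_series.
  rewrite (filterlim_C eventually (sum_n (G := C_NormedModule) a) l).
  assert (E1 : forall n, Re (sum_n (G := C_NormedModule) a n) = sum_n (fun k => Re (a k)) n)
    by (intros n; rewrite sum_n_C; reflexivity).
  assert (E2 : forall n, Im (sum_n (G := C_NormedModule) a n) = sum_n (fun k => Im (a k)) n)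
    by (intros n; rewrite sum_n_C; reflexivity).
  split; intros [H1 H2]; split.
  - exact (filterlim_ext _ _ E1 H1).
  - exact (filterlim_ext _ _ E2 H2).
  - exact (filterlim_ext _ _ (fun n => eq_sym (E1 n)) H1).
  - exact (filterlim_ext _ _ (fun n => eq_sym (E2 n)) H2).
Qed.

Lemma is_Cseries_unique (a : nat -> C) (l1 l2 : C) :
  is_series (V := C_NormedModule) a l1 -> is_series (V := C_NormedModule) a l2 -> l1 = l2.
Proof. apply (filterlim_locally_unique (V := C_NormedModule)). Qed.

Lemma CSeries_unique (a : nat -> C) (l : C) :
  is_series (V := C_NormedModule) a l -> CSeries a = l.
Proof.
  intros H. apply (iota_unique (V := C_CompleteNormedModule)); [|exact H].
  intros y Hy. exact (is_Cseries_unique a y l Hy H).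
Qed.

Lemma is_Cseries_scal (c : C) (a : nat -> C) (l : C) :
  is_series (V := C_NormedModule) a l ->
  is_series (V := C_NormedModule) (fun k => (c * a k)%C) (c * l)%C.
Proof. exact (is_series_scal (V := C_NormedModule) c a l). Qed.

Lemma Cmod_series_le (a : nat -> C) (l : C) (b : nat -> R) (B : R) :
  is_series (V := C_NormedModule) a l -> is_series b B ->
  (forall k, Cmod (a k) <= b k) -> Cmod l <= B.
Proof.
  intros Ha Hb Hab.
  apply (filterlim_le (F := eventually) (fun n => Cmod (sum_n (G := C_NormedModule) a n))
           (sum_n b) (Finite (Cmod l)) (Finite B)).
  - apply filter_forall. intros n.
    eapply Rle_trans; [exact (norm_sum_n_m (V := C_NormedModule) a 0 n)|].
    apply sum_n_m_le. exact Hab.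
  - exact (filterlim_comp _ _ _ _ _ _ _ _ Ha (filterlim_norm (V := C_NormedModule) l)).
  - exact Hb.
Qed.

Lemma ex_Cseries_le (a : nat -> C) (b : nat -> R) :
  (forall k, Cmod (a k) <= b k) -> ex_series b ->
  exists l : C, is_series (V := C_NormedModule) a l.
Proof. exact (ex_series_le (V := C_CompleteNormedModule) a b). Qed.

Lemma is_series_exp (r : R) : is_series (fun k => r ^ k / INR (fact k)) (exp r).
Proof.
  generalize (proj1 (is_pseries_R _ _ _) (is_exp_Reals r)).
  apply is_series_ext. intros n. unfold Rdiv. apply Rmult_comm.
Qed.

Lemma exp_term_le (u : R) (n : nat) : 0 <= u -> u ^ n / INR (fact n) <= exp u.
Proof.
  intros Hu. apply Rle_trans with (2 := exp_ge_taylor u n Hu).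
  assert (H : forall k, 0 <= u ^ k / INR (fact k)).
  { intros k. apply Rdiv_le_0_compat; [apply pow_le, Hu | apply INR_fact_lt_0]. }
  destruct n; simpl sum_f_R0; [apply Rle_refl|].
  assert (H' := cond_pos_sum (fun k => u ^ k / INR (fact k)) n H). simpl. lra.
Qed.

(** For every x >= 0 the terms a_k x^k stay below M exp (r x), because a single term of the
    exponential series is at most its sum; hence no finite radius is possible. *)
Lemma CV_radius_fact (a : nat -> R) (M r : R) :
  0 <= r -> (forall k, Rabs (a k) <= M * (r ^ k / INR (fact k))) ->
  CV_radius a = p_infty.
Proof.
  intros Hr Ha.
  assert (HM : 0 <= M).
  { assert (H := Ha 0%nat). assert (H' := Rabs_pos (a 0%nat)). simpl in H. lra. }
  assert (H : forall x : R, 0 <= x -> Rbar_le x (CV_radius a)).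
  { intros x Hx. apply (proj1 (CV_radius_bounded a)). exists (M * exp (r * x)). intros n.
    rewrite Rabs_mult, (Rabs_pos_eq (x ^ n)) by (apply pow_le, Hx).
    apply Rle_trans with (M * (r ^ n / INR (fact n)) * x ^ n).
    - apply Rmult_le_compat_r; [apply pow_le, Hx | apply Ha].
    - replace (_ * _) with (M * ((r * x) ^ n / INR (fact n)))
        by (rewrite Rpow_mult_distr; unfold Rdiv; ring).
      apply Rmult_le_compat_l; [exact HM|]. apply exp_term_le. nra. }
  destruct (CV_radius a) as [c| |]; try reflexivity.
  - assert (H0 := H 0 (Rle_refl 0)). assert (H1 := H (c + 1)). simpl in *. lra.
  - now assert (H0 := H 0 (Rle_refl 0)).
Qed.

(** The variable is real and only the coefficients are complex, so that the theory of real power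
    series applies to each component. *)
Definition CPSeries (c : nat -> C) (s : R) : C :=
  (PSeries (fun k => Re (c k)) s, PSeries (fun k => Im (c k)) s).

(** Domination by the exponential series, which both the series of exp and that of the primitive
    satisfy; it yields infinite radius of convergence and explicit bounds on the sum. *)
Definition fact_bounded (c : nat -> C) (M r : R) : Prop :=
  0 <= r /\ forall k, Cmod (c k) <= M * (r ^ k / INR (fact k)).

Lemma im_le_Cmod (z : C) : Rabs (Im z) <= Cmod z.
Proof. apply Rle_trans with (2 := Rmax_Cmod z), Rmax_r. Qed.

Lemma fact_bounded_CV_radius (c : nat -> C) (M r : R) : fact_bounded c M r ->
  CV_radius (fun k => Re (c k)) = p_infty /\ CV_radius (fun k => Im (c k)) = p_infty.
Proof.
  intros [Hr Hc]. split; apply (CV_radius_fact _ M r Hr); intros k;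
    apply Rle_trans with (2 := Hc k); [apply re_le_Cmod | apply im_le_Cmod].
Qed.

Lemma is_series_PSeries (a : nat -> R) (s : R) :
  CV_radius a = p_infty -> is_series (fun k => a k * s ^ k) (PSeries a s).
Proof.
  intros H. apply is_pseries_R, PSeries_correct, CV_radius_inside. rewrite H. exact I.
Qed.

Lemma is_series_CPSeries_aux (c : nat -> C) (s : R) :
  CV_radius (fun k => Re (c k)) = p_infty -> CV_radius (fun k => Im (c k)) = p_infty ->
  is_series (V := C_NormedModule) (fun k => (c k * RtoC s ^ k)%C) (CPSeries c s).
Proof.
  intros H1 H2. apply is_series_C. simpl. split.
  - generalize (is_series_PSeries _ s H1). apply is_series_ext. intros k.
    rewrite <- RtoC_pow. symmetry; apply re_scal_r.
  - generalize (is_series_PSeries _ s H2). apply is_series_ext. intros k.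
    rewrite <- RtoC_pow. symmetry; apply im_scal_r.
Qed.

Lemma is_series_CPSeries (c : nat -> C) (M r s : R) : fact_bounded c M r ->
  is_series (V := C_NormedModule) (fun k => (c k * RtoC s ^ k)%C) (CPSeries c s).
Proof.
  intros H. destruct (fact_bounded_CV_radius _ _ _ H). now apply is_series_CPSeries_aux.
Qed.

Lemma is_derive_CPSeries (c : nat -> C) (M r s : R) : fact_bounded c M r ->
  exists l : C, is_derive (V := C_R_NormedModule) (CPSeries c) s l /\
    is_series (V := C_NormedModule) (fun k => (RtoC (INR (S k)) * c (S k) * RtoC s ^ k)%C) l.
Proof.
  intros H. destruct (fact_bounded_CV_radius _ _ _ H) as [H1 H2].
  exists (CPSeries (fun k => (RtoC (INR (S k)) * c (S k))%C) s). split.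
  - apply is_derive_RC. split; simpl.
    + replace (PSeries _ s) with (PSeries (PS_derive (fun k => Re (c k))) s)
        by (apply PSeries_ext; intros k; symmetry; apply re_scal_l).
      apply is_derive_PSeries. rewrite H1. exact I.
    + replace (PSeries _ s) with (PSeries (PS_derive (fun k => Im (c k))) s)
        by (apply PSeries_ext; intros k; symmetry; apply im_scal_l).
      apply is_derive_PSeries. rewrite H2. exact I.
  - apply is_series_CPSeries_aux.
    + rewrite <- H1, <- (CV_radius_derive (fun k => Re (c k))).
      apply CV_radius_ext. intros k. apply re_scal_l.
    + rewrite <- H2, <- (CV_radius_derive (fun k => Im (c k))).
      apply CV_radius_ext. intros k. apply im_scal_l.
Qed.

(** The Euler operator s d/ds multiplies the k-th term by k; the shift of index costs nothing
    because the term at k = 0 vanishes. *)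
Lemma is_series_mult_index (c : nat -> C) (s : R) (l : C) :
  is_series (V := C_NormedModule) (fun k => (RtoC (INR (S k)) * c (S k) * RtoC s ^ k)%C) l ->
  is_series (V := C_NormedModule) (fun k => (RtoC (INR k) * c k * RtoC s ^ k)%C) (RtoC s * l)%C.
Proof.
  intros H. apply (is_series_decr_1 (V := C_NormedModule)).
  match goal with |- is_series _ ?l' => replace l' with (RtoC s * l)%C end.
  2:{ unfold plus, opp; simpl. rewrite Cmult_0_l, Cmult_0_l, Copp_0. symmetry; apply Cplus_0_r. }
  apply (is_series_ext (V := C_NormedModule)
    (fun k => (RtoC s * ((RtoC (INR (S k)) * c (S k)) * RtoC s ^ k))%C)).
  { intros k. rewrite Cpow_S. simpl. ring. }
  apply is_Cseries_scal, H.
Qed.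

Lemma RtoC_fact_neq_0 (k : nat) : RtoC (INR (fact k)) <> 0%C.
Proof. intros H. apply (INR_fact_neq_0 k). exact (f_equal Re H). Qed.

Lemma Cmod_exp_coeff (z : C) (k : nat) :
  Cmod (z ^ k / RtoC (INR (fact k))) = Cmod z ^ k / INR (fact k).
Proof.
  rewrite Cmod_div by apply RtoC_fact_neq_0.
  rewrite Cmod_pow, Cmod_R, Rabs_pos_eq by apply pos_INR. reflexivity.
Qed.

Lemma CPSeries_0 (c : nat -> C) : CPSeries c 0 = c 0%nat.
Proof. unfold CPSeries. rewrite !PSeries_0. symmetry; apply surjective_pairing. Qed.

Lemma is_series_Cexp (z : C) :
  is_series (V := C_NormedModule) (fun k => (z ^ k / RtoC (INR (fact k)))%C) (Cexp z).
Proof.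
  set (c := fun k => (z ^ k / RtoC (INR (fact k)))%C).
  assert (Hc : fact_bounded c 1 (Cmod z)).
  { split; [apply Cmod_ge_0|]. intros k. unfold c. rewrite Cmod_exp_coeff. lra. }
  (* The quotient by [Cexp (s z)] of the series [sum (s z)^k / k!] has derivative zero. *)
  assert (Hd : forall s, is_derive (V := C_R_NormedModule)
      (fun s => (CPSeries c s * Cexp (- z * RtoC s))%C) s zero).
  { intros s. destruct (is_derive_CPSeries c 1 (Cmod z) s Hc) as [l [Hl1 Hl2]].
    assert (El : l = (z * CPSeries c s)%C).
    { apply (is_Cseries_unique _ _ _ Hl2).
      generalize (is_Cseries_scal z _ _ (is_series_CPSeries c 1 (Cmod z) s Hc)).
      apply (is_series_ext (V := C_NormedModule)). intros k. unfold c.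
      rewrite fact_simpl, mult_INR, RtoC_mult, Cpow_S.
      match goal with |- ?a = ?b => change (@eq C a b) end.
      field. split; [apply RtoC_fact_neq_0|].
      intros h. apply (f_equal Re) in h. apply (not_0_INR (S k)) in h; [exact h|discriminate]. }
    assert (H := is_derive_RC_mult _ _ _ _ _ Hl1
                   (is_derive_RC_Cexp (- z) (fun s => s) s 1 (is_derive_id s))).
    replace (zero : C_R_NormedModule) with
      (l * Cexp (- z * RtoC s) + CPSeries c s * (- z * RtoC 1 * Cexp (- z * RtoC s)))%C;
      [exact H|].
    rewrite El. match goal with |- ?a = _ => change (a = RtoC 0) end. ring. }
  (* Constancy on [0, 1] compares the value at s = 1 with the one at s = 0, where only [c 0] = 1
     survives. *)
  assert (E := eq_is_derive _ 0 1 (fun s _ => Hd s) Rlt_0_1). simpl in E.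
  rewrite CPSeries_0, Cmult_0_r, Cexp_0, !Cmult_1_r in E.
  assert (Hs := is_series_CPSeries c 1 (Cmod z) 1 Hc).
  replace (CPSeries c 1) with (Cexp z) in Hs.
  - apply (is_series_ext (V := C_NormedModule)) with (2 := Hs).
    intros k. rewrite Cpow_1_l, Cmult_1_r. reflexivity.
  - transitivity (Cexp z * c 0%nat)%C.
    + unfold c. simpl. field.
    + rewrite E. rewrite Cmult_comm, <- Cmult_assoc, Cexp_opp. ring.
Qed.

(** * The primitive of the gamma integrand *)

(** The fundamental theorem of calculus with a possible singularity at 0. The upper filter stays
    abstract: it is [at_point 1] for the incomplete gamma function and a neighbourhood of infinity
    for Euler's integral. *)
Lemma is_RInt_gen_primitive (F f : R -> C) (Fb : (R -> Prop) -> Prop) {FFb : Filter Fb}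
  (la lb : C) :
  (forall t, 0 < t -> is_derive (V := C_R_NormedModule) F t (f t)) ->
  (forall t, 0 < t -> continuous (U := C_R_NormedModule) f t) ->
  Fb (fun b => 0 < b) ->
  filterlim F (at_right 0) (locally la) -> filterlim F Fb (locally lb) ->
  is_RInt_gen (V := C_R_NormedModule) f (at_right 0) Fb (lb - la)%C.
Proof.
  intros HF Hf Hpos Ha Hb.
  apply (filterlimi_lim_ext_loc (fun ab : R * R => (F (snd ab) - F (fst ab))%C)).
  - apply (Filter_prod (at_right 0) Fb _ (fun a => 0 < a) (fun b => 0 < b)).
    + exists (mkposreal 1 Rlt_0_1). intros; assumption.
    + exact Hpos.
    + intros a b ha hb.
      apply (is_RInt_derive (V := C_R_CompleteNormedModule) F f);
        intros t Ht; [apply HF | apply Hf];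
        (apply Rlt_le_trans with (2 := proj1 Ht); simpl; apply Rmin_glb_lt; assumption).
  - destruct (proj1 (filterlim_C _ F la) Ha) as [Ha1 Ha2].
    destruct (proj1 (filterlim_C _ F lb) Hb) as [Hb1 Hb2].
    assert (G : forall (u : R -> R) (x y : R), filterlim u (at_right 0) (locally x) ->
      filterlim u Fb (locally y) ->
      filterlim (fun ab : R * R => u (snd ab) - u (fst ab))
        (filter_prod (at_right 0) Fb) (locally (y - x))).
    { intros u x y Hx Hy.
      apply (filterlim_comp_2 (G := locally y) (H := locally (- x))
        (fun ab : R * R => u (snd ab)) (fun ab : R * R => - u (fst ab)) Rplus).
      - exact (filterlim_comp _ _ _ _ _ _ _ _ filterlim_snd Hy).
      - apply (filterlim_comp _ _ _ (fun ab : R * R => u (fst ab)) Ropp _ (locally x)).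
        + exact (filterlim_comp _ _ _ _ _ _ _ _ filterlim_fst Hx).
        + exact (filterlim_opp x).
      - exact (filterlim_plus y (- x)). }
    apply (filterlim_C (filter_prod (at_right 0) Fb)).
    split; [apply (G (fun t => Re (F t))) | apply (G (fun t => Im (F t)))];
      assumption.
Qed.

Lemma CRInt_gen_unique (f : R -> C) (Fa Fb : (R -> Prop) -> Prop)
  {FFa : ProperFilter' Fa} {FFb : ProperFilter' Fb} (l : C) :
  is_RInt_gen (V := C_R_NormedModule) f Fa Fb l -> CRInt_gen f Fa Fb = l.
Proof. exact (is_RInt_gen_unique (V := C_R_CompleteNormedModule) f l). Qed.

Lemma exp_monotone (a b : R) : a <= b -> exp a <= exp b.
Proof. intros [H| ->]; [left; now apply exp_increasing | apply Rle_refl]. Qed.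

(** The power of -x belongs to the coefficient, which leaves the real position on the segment as the
    variable; the series P is the value at 1. *)
Definition gamma_coeff (mu x : C) (k : nat) : C :=
  ((- x) ^ k / RtoC (INR (fact k)) / (mu + RtoC (INR k)))%C.

Lemma Cmod_shift_ge (mu : C) (k : nat) : Re mu <= Cmod (mu + RtoC (INR k)).
Proof.
  apply Rle_trans with (2 := Rle_trans _ _ _ (Rle_abs _) (re_le_Cmod _)).
  simpl. assert (H := pos_INR k). unfold Re. lra.
Qed.

Lemma shift_neq_0 (mu : C) (k : nat) : 0 < Re mu -> (mu + RtoC (INR k))%C <> 0%C.
Proof. intros H. apply Cmod_gt_0. assert (H' := Cmod_shift_ge mu k). lra. Qed.

Lemma gamma_coeff_bounded (mu x : C) : 0 < Re mu ->
  fact_bounded (gamma_coeff mu x) (/ Re mu) (Cmod x).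
Proof.
  intros Hmu. split; [apply Cmod_ge_0|]. intros k. unfold gamma_coeff.
  rewrite Cmod_div by (apply shift_neq_0, Hmu).
  rewrite Cmod_exp_coeff, Cmod_opp, Rmult_comm. unfold Rdiv at 1.
  apply Rmult_le_compat_l.
  - apply Rdiv_le_0_compat; [apply pow_le, Cmod_ge_0 | apply INR_fact_lt_0].
  - apply Rinv_le_contravar; [exact Hmu | apply Cmod_shift_ge].
Qed.

(* The primitive of [t^(mu-1) e^(-xt)] vanishing at 0. *)
Definition gamma_primitive (mu x : C) (t : R) : C :=
  (Cexp (mu * RtoC (ln t)) * CPSeries (gamma_coeff mu x) t)%C.

(** Stated with the real logarithm, so that no argument function is involved for t > 0; x = 1 gives
    Euler's integrand. *)
Definition gamma_integrand (mu x : C) (t : R) : C :=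
  (Cexp ((mu - 1) * RtoC (ln t)) * Cexp (- x * RtoC t))%C.

Lemma is_derive_gamma_integrand (mu x : C) (t : R) : 0 < t ->
  exists l, is_derive (V := C_R_NormedModule) (gamma_integrand mu x) t l.
Proof.
  intros Ht. eexists. apply is_derive_RC_mult.
  - apply is_derive_RC_Cexp, is_derive_ln, Ht.
  - apply (is_derive_RC_Cexp (- x) (fun s => s) t 1 (is_derive_id t)).
Qed.

Lemma continuous_gamma_integrand (mu x : C) (t : R) : 0 < t ->
  continuous (U := C_R_NormedModule) (gamma_integrand mu x) t.
Proof.
  intros Ht. apply (ex_derive_continuous (V := C_R_NormedModule)).
  exact (is_derive_gamma_integrand mu x t Ht).
Qed.

Lemma Cexp_RtoC (r : R) : Cexp (RtoC r) = RtoC (exp r).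
Proof. unfold Cexp; simpl. rewrite cos_0, sin_0, Rmult_0_r, Rmult_1_r. reflexivity. Qed.

Lemma Cexp_minus_one_ln (mu : C) (t : R) : 0 < t ->
  (Cexp ((mu - 1) * RtoC (ln t)) * RtoC t)%C = Cexp (mu * RtoC (ln t)).
Proof.
  intros Ht. rewrite <- (exp_ln t) at 2 by exact Ht. rewrite <- Cexp_RtoC, <- Cexp_plus.
  f_equal. ring.
Qed.

Lemma is_derive_gamma_primitive (mu x : C) (t : R) : 0 < Re mu -> 0 < t ->
  is_derive (V := C_R_NormedModule) (gamma_primitive mu x) t (gamma_integrand mu x t).
Proof.
  intros Hmu Ht. assert (Hc := gamma_coeff_bounded mu x Hmu).
  destruct (is_derive_CPSeries _ _ _ t Hc) as [l [Hl1 Hl2]].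
  assert (Ht' : RtoC t <> 0%C).
  { intros h. apply (f_equal Re) in h. simpl in h. lra. }
  (* The operator t d/dt + mu multiplies the k-th term by mu + k, which cancels the denominator and
     leaves the exponential series. *)
  assert (E : (RtoC t * l + mu * CPSeries (gamma_coeff mu x) t)%C = Cexp (- x * RtoC t)).
  { apply (is_Cseries_unique (fun k => ((- x * RtoC t) ^ k / RtoC (INR (fact k)))%C)).
    - generalize (is_series_plus (V := C_NormedModule) _ _ _ _
        (is_series_mult_index _ _ _ Hl2) (is_Cseries_scal mu _ _ (is_series_CPSeries _ _ _ t Hc))).
      apply (is_series_ext (V := C_NormedModule)). intros k.
      match goal with |- ?a = ?b => change (@eq C a b) end.
      unfold plus, gamma_coeff; simpl. rewrite Cpow_mult_l. field.
      split; [apply RtoC_fact_neq_0 | apply shift_neq_0, Hmu].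
    - apply is_series_Cexp. }
  assert (H := is_derive_RC_mult _ _ _ _ _
    (is_derive_RC_Cexp mu ln t (/ t) (is_derive_ln t Ht)) Hl1).
  replace (gamma_integrand mu x t) with
    (mu * RtoC (/ t) * Cexp (mu * RtoC (ln t)) * CPSeries (gamma_coeff mu x) t +
     Cexp (mu * RtoC (ln t)) * l)%C; [exact H|].
  unfold gamma_integrand. rewrite <- E, <- (Cexp_minus_one_ln mu t Ht), RtoC_inv by lra.
  field. exact Ht'.
Qed.

Lemma Cmod_gamma_primitive_le (mu x : C) (t : R) : 0 < Re mu -> 0 < t ->
  Cmod (gamma_primitive mu x t) <= exp (Re mu * ln t) * (/ Re mu * exp (Cmod x * t)).
Proof.
  intros Hmu Ht. unfold gamma_primitive. rewrite Cmod_mult, Cmod_Cexp, re_scal_r.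
  apply Rmult_le_compat_l; [left; apply exp_pos|].
  assert (Hc := gamma_coeff_bounded mu x Hmu).
  apply (Cmod_series_le _ _ (fun k => / Re mu * ((Cmod x * t) ^ k / INR (fact k)))
    _ (is_series_CPSeries _ _ _ t Hc)).
  - apply (is_series_scal_l (V := R_NormedModule) (/ Re mu)), is_series_exp.
  - intros k. rewrite Cmod_mult, Cmod_pow, Cmod_R, Rabs_pos_eq by lra.
    rewrite Rpow_mult_distr.
    apply Rle_trans with (/ Re mu * (Cmod x ^ k / INR (fact k)) * t ^ k).
    + apply Rmult_le_compat_r; [apply pow_le; lra | apply Hc].
    + right. unfold Rdiv. ring.
Qed.

Lemma filterlim_C_squeeze {T : Type} (F : (T -> Prop) -> Prop) {FF : Filter F}
  (f : T -> C) (g : T -> R) :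
  F (fun t => Cmod (f t) <= g t) -> filterlim g F (locally 0) -> filterlim f F (locally (RtoC 0)).
Proof.
  intros Hfg Hg. apply (filterlim_locally (U := C_UniformSpace)). intros eps.
  generalize (filter_and _ _ Hfg (proj1 (filterlim_locally _ _) Hg eps)).
  apply filter_imp. intros t [h1 h2]. apply C_NormedModule_mixin_compat1.
  apply Rle_lt_trans with (g t).
  - apply Rle_trans with (2 := h1). right. f_equal.
    match goal with |- ?a = ?b => change (f t - RtoC 0 = f t)%C end. ring.
  - apply Rle_lt_trans with (1 := Rle_abs _).
    unfold ball in h2; simpl in h2; unfold AbsRing_ball, minus, plus, opp, abs in h2; simpl in h2.
    rewrite Ropp_0, Rplus_0_r in h2. exact h2.
Qed.

Lemma filterlim_exp_ln_0 (a : R) : 0 < a ->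
  filterlim (fun t => exp (a * ln t)) (at_right 0) (locally 0).
Proof.
  intros Ha. apply (filterlim_comp _ _ _ (fun t => a * ln t) exp _ (Rbar_locally m_infty)).
  - apply (filterlim_comp _ _ _ ln (Rmult a) _ (Rbar_locally m_infty)); [apply is_lim_ln_0|].
    replace m_infty with (Rbar_mult a m_infty) at 2.
    + apply filterlim_Rbar_mult_l.
    + simpl. destruct Rle_dec as [h|h]; [destruct Rle_lt_or_eq_dec|]; (reflexivity || lra).
  - exact is_lim_exp_m.
Qed.

Lemma filterlim_gamma_primitive_0 (mu x : C) : 0 < Re mu ->
  filterlim (gamma_primitive mu x) (at_right 0) (locally (RtoC 0)).
Proof.
  intros Hmu.
  apply (filterlim_C_squeeze (at_right 0) _
    (fun t => exp (Re mu * ln t) * (/ Re mu * exp (Cmod x)))).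
  - exists (mkposreal 1 Rlt_0_1). intros t Ht Ht0.
    assert (Ht1 : t < 1).
    { unfold ball in Ht; simpl in Ht; unfold AbsRing_ball, minus, plus, opp, abs in Ht; simpl in Ht.
      apply Rabs_lt_between in Ht. lra. }
    apply Rle_trans with (1 := Cmod_gamma_primitive_le mu x t Hmu Ht0).
    apply Rmult_le_compat_l; [left; apply exp_pos|].
    apply Rmult_le_compat_l; [left; apply Rinv_0_lt_compat, Hmu|].
    assert (Hx := Cmod_ge_0 x). apply exp_monotone. nra.
  - replace 0 with (0 * (/ Re mu * exp (Cmod x))) at 2 by ring.
    apply (filterlim_comp _ _ _ (fun t => exp (Re mu * ln t)) (fun u => u * (/ Re mu * exp (Cmod x)))
      _ (locally 0)).
    + apply filterlim_exp_ln_0, Hmu.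
    + exact (filterlim_scal_l (V := R_NormedModule) 0 (/ Re mu * exp (Cmod x))).
Qed.

(** * Series for the lower incomplete gamma function *)

(** An improper integral is a limit of proper ones, so commuting with those and continuity at the
    limit suffice. It is applied to [Re] and to multiplication by a complex constant, whereas the
    scalars of the integral are real. *)
Lemma is_RInt_gen_linear {V W : NormedModule R_AbsRing} (T : V -> W)
  (Fa Fb : (R -> Prop) -> Prop) {FFa : Filter Fa} {FFb : Filter Fb} (f : R -> V) (l : V) :
  (forall a b y, is_RInt f a b y -> is_RInt (fun t => T (f t)) a b (T y)) ->
  continuous T l ->
  is_RInt_gen f Fa Fb l -> is_RInt_gen (fun t => T (f t)) Fa Fb (T l).
Proof.
  intros HT Hc H P HP.
  generalize (H _ (Hc P HP)). unfold filtermapi. apply filter_imp.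
  intros ab [y [Hy1 Hy2]]. exists (T y). split; [apply HT, Hy1 | exact Hy2].
Qed.

Lemma is_RInt_gen_Re (Fa Fb : (R -> Prop) -> Prop) {FFa : Filter Fa} {FFb : Filter Fb}
  (f : R -> C) (l : C) :
  is_RInt_gen (V := C_R_NormedModule) f Fa Fb l ->
  is_RInt_gen (fun t => Re (f t)) Fa Fb (Re l).
Proof.
  apply (is_RInt_gen_linear (V := C_R_NormedModule) (W := R_NormedModule) Re Fa Fb f l).
  - intros a b y. exact (is_RInt_fct_extend_fst (U := R_NormedModule) (V := R_NormedModule) f a b y).
  - exact (continuous_fst (U := R_UniformSpace) (V := R_UniformSpace) (fst l) (snd l)).
Qed.

Lemma continuous_Cmult_l (c l : C) : continuous (U := C_UniformSpace) (fun z => (c * z)%C) l.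
Proof.
  assert (H1 : continuous (fun z : C_UniformSpace => Re z) l)
    by exact (continuous_fst (U := R_UniformSpace) (V := R_UniformSpace) (fst l) (snd l)).
  assert (H2 : continuous (fun z : C_UniformSpace => Im z) l)
    by exact (continuous_snd (U := R_UniformSpace) (V := R_UniformSpace) (fst l) (snd l)).
  apply (filterlim_C (locally (l : C_UniformSpace))). split.
  - exact (continuous_minus (V := R_NormedModule) _ _ l
      (continuous_scal_r (V := R_NormedModule) (Re c) _ l H1)
      (continuous_scal_r (V := R_NormedModule) (Im c) _ l H2)).
  - exact (continuous_plus (V := R_NormedModule) _ _ l
      (continuous_scal_r (V := R_NormedModule) (Re c) _ l H2)
      (continuous_scal_r (V := R_NormedModule) (Im c) _ l H1)).
Qed.

Lemma is_RInt_gen_Cmult (Fa Fb : (R -> Prop) -> Prop) {FFa : Filter Fa} {FFb : Filter Fb}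
  (c : C) (f : R -> C) (l : C) :
  is_RInt_gen (V := C_R_NormedModule) f Fa Fb l ->
  is_RInt_gen (V := C_R_NormedModule) (fun t => (c * f t)%C) Fa Fb (c * l)%C.
Proof.
  apply (is_RInt_gen_linear (V := C_R_NormedModule) (W := C_R_NormedModule) (Cmult c) Fa Fb f l).
  - intros a b y Hy.
    assert (H1 := is_RInt_fct_extend_fst (U := R_NormedModule) (V := R_NormedModule) f a b y Hy).
    assert (H2 := is_RInt_fct_extend_snd (U := R_NormedModule) (V := R_NormedModule) f a b y Hy).
    apply (is_RInt_fct_extend_pair (U := R_NormedModule) (V := R_NormedModule)).
    + exact (is_RInt_minus (V := R_NormedModule) _ _ a b _ _
        (is_RInt_scal (V := R_NormedModule) _ a b (Re c) _ H1)
        (is_RInt_scal (V := R_NormedModule) _ a b (Im c) _ H2)).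
    + exact (is_RInt_plus (V := R_NormedModule) _ _ a b _ _
        (is_RInt_scal (V := R_NormedModule) _ a b (Re c) _ H2)
        (is_RInt_scal (V := R_NormedModule) _ a b (Im c) _ H1)).
  - apply continuous_Cmult_l.
Qed.

(** Positive scaling keeps the argument, so the open segment from 0 to x never crosses the branch
    cut, even when x is a negative real. *)
Lemma Clog_scal (s : R) (x : C) : 0 < s -> x <> 0%C ->
  Clog (RtoC s * x) = (RtoC (ln s) + Clog x)%C.
Proof.
  intros Hs Hx. apply Cmod_gt_0 in Hx. unfold Clog.
  assert (E : Carg (RtoC s * x) = Carg x).
  { unfold Carg. rewrite im_scal_l, re_scal_l, Cmod_mult, Cmod_R, Rabs_pos_eq by lra.
    replace (s * Re x / (s * Cmod x)) with (Re x / Cmod x) by (field; lra).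
    destruct (Rle_dec 0 (s * Im x)), (Rle_dec 0 (Im x)); try reflexivity; exfalso; nra. }
  rewrite E, Cmod_mult, Cmod_R, Rabs_pos_eq, ln_mult by lra.
  apply C_eq; simpl; ring.
Qed.

Lemma lower_gamma_series (mu x : C) : 0 < Re mu -> x <> 0%C ->
  lower_gamma mu x = (Cpower x mu * CPSeries (gamma_coeff mu x) 1)%C.
Proof.
  intros Hmu Hx. unfold lower_gamma, Csegment_int.
  apply (CRInt_gen_unique _ (at_right 0) (at_point 1)).
  replace (CPSeries (gamma_coeff mu x) 1) with (gamma_primitive mu x 1 - 0)%C.
  2:{ unfold gamma_primitive. rewrite ln_1, Cmult_0_r, Cexp_0. ring. }
  apply (is_RInt_gen_ext (V := C_R_NormedModule)
    (Fa := at_right 0) (Fb := at_point 1)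
    (fun s => (Cpower x mu * gamma_integrand mu x s)%C)).
  - apply (Filter_prod (at_right 0) (at_point 1) _ (fun a => 0 < a) (fun b => 1 = b)).
    + exists (mkposreal 1 Rlt_0_1). intros; assumption.
    + reflexivity.
    + intros a b Ha <- s Hs. simpl in Hs.
      assert (Hs0 : 0 < s)
        by (apply Rlt_trans with (2 := proj1 Hs), Rmin_glb_lt; lra).
      replace (RtoC 0 + RtoC s * (x - 0))%C with (RtoC s * x)%C by ring.
      (* The Jacobian x becomes an exponential too, raising the exponent mu - 1 of x to mu. *)
      replace (x - 0)%C with (Cexp (Clog x)) at 1 by (rewrite Cexp_Clog by exact Hx; ring).
      unfold gamma_integrand, Cpower. rewrite Clog_scal by assumption.
      rewrite !Cmult_assoc, <- !Cexp_plus. f_equal. ring.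
  - apply (is_RInt_gen_Cmult (at_right 0) (at_point 1)).
    apply (is_RInt_gen_primitive (gamma_primitive mu x) _ (at_point 1)).
    + intros t Ht. apply is_derive_gamma_primitive; assumption.
    + intros t Ht. apply continuous_gamma_integrand, Ht.
    + exact Rlt_0_1.
    + apply filterlim_gamma_primitive_0, Hmu.
    (* [at_point 1] sees only the value at 1, so no continuity is called for. *)
    + intros P HP. exact (locally_singleton _ _ HP).
Qed.

(** * Complex differentiation in the parameter *)

(* The two normed modules have the same norm but different uniform structures. *)
Lemma is_derive_C_AbsRing (f : C -> C) (z l : C) :
  is_derive (K := C_AbsRing) (V := AbsRing_NormedModule C_AbsRing) f z l <->
  is_derive (K := C_AbsRing) (V := C_NormedModule) f z l.
Proof. split; intros [_ H]; (split; [apply is_linear_scal_l | exact H]). Qed.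

Lemma is_derive_C_quadratic (f : C -> C) (nu l : C) (delta M : R) : 0 < delta ->
  (forall mu, Cmod (mu - nu) < delta ->
    Cmod (f mu - f nu - (mu - nu) * l) <= M * Cmod (mu - nu) ^ 2) ->
  is_derive (K := C_AbsRing) (V := C_NormedModule) f nu l.
Proof.
  intros Hd Hf. split; [apply is_linear_scal_l|].
  intros z Hz. apply (is_filter_lim_locally_unique (V := AbsRing_NormedModule C_AbsRing)) in Hz.
  subst z. intros eps.
  (* Within eps / (|M| + 1) the quadratic bound is at most eps times the distance; the form |M| + 1
     is positive whatever the sign of [M]. *)
  assert (Hd' : 0 < Rmin delta (eps / (Rabs M + 1))).
  { apply Rmin_glb_lt; [exact Hd|]. apply Rdiv_lt_0_compat; [apply cond_pos|].
    assert (H := Rabs_pos M). lra. }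
  exists (mkposreal _ Hd'). intros mu Hmu.
  change (Cmod (mu - nu) < Rmin delta (eps / (Rabs M + 1))) in Hmu.
  change (Cmod (f mu - f nu - (mu - nu) * l) <= eps * Cmod (mu - nu)).
  assert (H1 := Rlt_le_trans _ _ _ Hmu (Rmin_l _ _)).
  assert (H2 := Rlt_le_trans _ _ _ Hmu (Rmin_r _ _)).
  apply Rle_trans with (1 := Hf mu H1).
  assert (H0 := Cmod_ge_0 (mu - nu)). assert (HM := Rabs_pos M). assert (HM' := Rle_abs M).
  apply Rlt_div_r in H2; [|lra].
  replace (M * Cmod (mu - nu) ^ 2) with (M * Cmod (mu - nu) * Cmod (mu - nu)) by ring.
  apply Rmult_le_compat_r; [exact H0|]. nra.
Qed.

(** The remainder is the series from index 2 on: factor out h^2 and use (k + 2)! >= k!. *)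
Lemma Cmod_Cexp_remainder_le (h : C) : Cmod (Cexp h - 1 - h) <= Cmod h ^ 2 * exp (Cmod h).
Proof.
  set (c := fun k => (h ^ k / RtoC (INR (fact k)))%C).
  assert (H : is_series (V := C_NormedModule) (fun k => c (2 + k)%nat) (Cexp h - 1 - h)%C).
  { apply (is_series_incr_n (V := C_NormedModule) c 2); [lia|].
    match goal with |- is_series _ ?l => replace l with (Cexp h) end; [apply is_series_Cexp|].
    simpl pred. rewrite sum_Sn, sum_O. unfold c, plus; simpl.
    match goal with |- ?a = ?b => change (@eq C a b) end. field. }
  apply (Cmod_series_le _ _ (fun k => Cmod h ^ 2 * (Cmod h ^ k / INR (fact k))) _ H).
  - apply (is_series_scal_l (V := R_NormedModule) (Cmod h ^ 2)), is_series_exp.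
  - intros k. unfold c. rewrite Cmod_exp_coeff, pow_add. unfold Rdiv. rewrite Rmult_assoc.
    assert (Hh := Cmod_ge_0 h).
    apply Rmult_le_compat_l; [apply pow_le, Hh|]. apply Rmult_le_compat_l; [apply pow_le, Hh|].
    apply Rinv_le_contravar; [apply INR_fact_lt_0|]. apply le_INR, fact_le. lia.
Qed.

Lemma is_derive_Cexp (z : C) :
  is_derive (K := C_AbsRing) (V := C_NormedModule) Cexp z (Cexp z).
Proof.
  apply (is_derive_C_quadratic _ _ _ 1 (Cmod (Cexp z) * exp 1) Rlt_0_1). intros w Hw.
  replace (Cexp w - Cexp z - (w - z) * Cexp z)%C
    with (Cexp z * (Cexp (w - z) - 1 - (w - z)))%C.
  2:{ replace (Cexp w) with (Cexp z * Cexp (w - z))%C by (rewrite <- Cexp_plus; f_equal; ring).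
      ring. }
  rewrite Cmod_mult, Rmult_assoc. apply Rmult_le_compat_l; [apply Cmod_ge_0|].
  apply Rle_trans with (1 := Cmod_Cexp_remainder_le (w - z)).
  rewrite Rmult_comm. apply Rmult_le_compat_r; [apply pow2_ge_0|]. apply exp_monotone. lra.
Qed.

Lemma is_derive_Cpower (x nu : C) :
  is_derive (K := C_AbsRing) (V := C_NormedModule) (Cpower x) nu (Clog x * Cpower x nu)%C.
Proof.
  apply (is_derive_comp (K := C_AbsRing) (V := C_NormedModule) Cexp (fun w => (w * Clog x)%C)).
  - apply is_derive_Cexp.
  - apply is_derive_C_AbsRing.
    apply (is_derive_C_quadratic (fun w => (w * Clog x)%C) nu (Clog x) 1 0 Rlt_0_1).
    intros mu _. replace (_ - _)%C with (RtoC 0) by ring. rewrite Cmod_0. lra.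
Qed.

(** The left side is exactly (mu - nu)^2 / ((mu + k) (nu + k)^2). The constant comes from |mu + k|
    >= Re nu / 2 and |nu + k| >= Re nu, and its independence of k is what allows summation. *)
Lemma inv_quadratic_remainder_le (nu mu : C) (k : nat) : 0 < Re nu ->
  Cmod (mu - nu) < Re nu / 2 ->
  Cmod (/ (mu + RtoC (INR k)) - / (nu + RtoC (INR k))
        + (mu - nu) / (nu + RtoC (INR k)) ^ 2) <= 2 / Re nu ^ 3 * Cmod (mu - nu) ^ 2.
Proof.
  intros Hnu Hmu.
  assert (Hre : Re nu / 2 < Re mu).
  { assert (H := Rle_lt_trans _ _ _ (re_le_Cmod _) Hmu).
    apply Rabs_lt_between in H. unfold Re in *. simpl in H. lra. }
  assert (H1 := shift_neq_0 nu k Hnu). assert (H2 : (mu + RtoC (INR k))%C <> 0%C)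
    by (apply shift_neq_0; lra).
  replace (_ + _)%C with ((mu - nu) ^ 2 * / ((mu + RtoC (INR k)) * (nu + RtoC (INR k)) ^ 2))%C
    by (field; split; assumption).
  assert (H3 : ((mu + RtoC (INR k)) * (nu + RtoC (INR k)) ^ 2)%C <> 0%C)
    by (apply Cmult_neq_0; [|apply Cpow_nz]; assumption).
  rewrite Cmod_mult, Cmod_inv, Cmod_mult, !Cmod_pow, Rmult_comm by exact H3.
  apply Rmult_le_compat_r; [apply pow2_ge_0|].
  replace (2 / Re nu ^ 3) with (/ (Re nu / 2 * Re nu ^ 2)) by (field; lra).
  apply Rinv_le_contravar; [apply Rmult_lt_0_compat; nra|].
  assert (H4 := Cmod_shift_ge nu k). assert (H5 := Cmod_shift_ge mu k).
  apply Rmult_le_compat; [lra | apply pow2_ge_0 | lra | apply pow_incr; lra].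
Qed.

Lemma is_series_gamma_coeff (mu x : C) : 0 < Re mu ->
  is_series (V := C_NormedModule) (gamma_coeff mu x) (CPSeries (gamma_coeff mu x) 1).
Proof.
  intros Hmu. generalize (is_series_CPSeries _ _ _ 1 (gamma_coeff_bounded mu x Hmu)).
  apply (is_series_ext (V := C_NormedModule)). intros k.
  rewrite Cpow_1_l. apply Cmult_1_r.
Qed.

Lemma is_derive_gamma_series (nu x D : C) : 0 < Re nu ->
  is_series (V := C_NormedModule)
    (fun k => ((- x) ^ k / RtoC (INR (fact k)) / (nu + RtoC (INR k)) ^ 2)%C) D ->
  is_derive (K := C_AbsRing) (V := C_NormedModule)
    (fun mu => CPSeries (gamma_coeff mu x) 1) nu (- D)%C.
Proof.
  intros Hnu HD.
  apply (is_derive_C_quadratic _ _ _ (Re nu / 2) (2 / Re nu ^ 3 * exp (Cmod x))); [lra|].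
  intros mu Hmu.
  assert (Hre : 0 < Re mu).
  { assert (H := Rle_lt_trans _ _ _ (re_le_Cmod _) Hmu).
    apply Rabs_lt_between in H. unfold Re in *. simpl in H. lra. }
  assert (H := is_series_plus (V := C_NormedModule) _ _ _ _
    (is_series_minus (V := C_NormedModule) _ _ _ _
      (is_series_gamma_coeff mu x Hre) (is_series_gamma_coeff nu x Hnu))
    (is_Cseries_scal (mu - nu) _ _ HD)).
  replace (_ - _)%C with (CPSeries (gamma_coeff mu x) 1 - CPSeries (gamma_coeff nu x) 1
                          + (mu - nu) * D)%C by ring.
  replace (2 / Re nu ^ 3 * exp (Cmod x) * Cmod (mu - nu) ^ 2)
    with (2 / Re nu ^ 3 * Cmod (mu - nu) ^ 2 * exp (Cmod x)) by ring.
  apply (Cmod_series_le _ _ (fun k => 2 / Re nu ^ 3 * Cmod (mu - nu) ^ 2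
    * (Cmod x ^ k / INR (fact k))) _ H).
  - apply (is_series_scal_l (V := R_NormedModule)), is_series_exp.
  - intros k.
    match goal with |- Cmod ?z <= _ => replace z with ((- x) ^ k / RtoC (INR (fact k)) *
      (/ (mu + RtoC (INR k)) - / (nu + RtoC (INR k)) + (mu - nu) / (nu + RtoC (INR k)) ^ 2))%C end.
    2:{ unfold plus, opp, gamma_coeff; simpl. field.
        repeat split; try apply RtoC_fact_neq_0; apply shift_neq_0; assumption. }
    rewrite Cmod_mult, Cmod_exp_coeff, Cmod_opp, Rmult_comm.
    apply Rmult_le_compat_r.
    + apply Rdiv_le_0_compat; [apply pow_le, Cmod_ge_0 | apply INR_fact_lt_0].
    + apply inv_quadratic_remainder_le; assumption.
Qed.

Lemma is_derive_lower_gamma (nu x D : C) : 0 < Re nu -> x <> 0%C ->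
  is_series (V := C_NormedModule)
    (fun k => ((- x) ^ k / RtoC (INR (fact k)) / (nu + RtoC (INR k)) ^ 2)%C) D ->
  is_derive (K := C_AbsRing) (V := C_NormedModule) (fun mu => lower_gamma mu x) nu
    (lower_gamma nu x * Clog x - Cpower x nu * D)%C.
Proof.
  intros Hnu Hx HD.
  apply (is_derive_ext_loc (K := C_AbsRing) (V := C_NormedModule)
    (fun mu => (Cpower x mu * CPSeries (gamma_coeff mu x) 1)%C)).
  (* The series formula requires Re mu > 0, which holds on the disc of radius [Re nu] around nu. *)
  { exists (mkposreal _ Hnu). intros mu Hmu.
    change (Cmod (mu - nu) < Re nu) in Hmu. symmetry. apply lower_gamma_series; [|exact Hx].
    assert (H := Rle_lt_trans _ _ _ (re_le_Cmod _) Hmu).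
    apply Rabs_lt_between in H. unfold Re in *. simpl in H. lra. }
  rewrite lower_gamma_series by assumption.
  assert (H := is_derive_mult (K := C_AbsRing) _ _ nu _ _
    (proj2 (is_derive_C_AbsRing _ _ _) (is_derive_Cpower x nu))
    (proj2 (is_derive_C_AbsRing _ _ _) (is_derive_gamma_series nu x D Hnu HD)) Cmult_comm).
  match type of H with is_derive _ _ ?l =>
    replace (_ - _)%C with (l : C); [apply is_derive_C_AbsRing, H|] end.
  unfold plus, mult; simpl. ring.
Qed.

(** * Euler's integral *)

Lemma Cmod_gamma_integrand (z : C) (t : R) :
  Cmod (gamma_integrand z 1 t) = exp ((Re z - 1) * ln t - t).
Proof.
  unfold gamma_integrand. rewrite Cmod_mult, !Cmod_Cexp, <- exp_plus, !re_scal_r.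
  f_equal. simpl. unfold Re. ring.
Qed.

Lemma Cmod_gamma_integrand_le (z : C) :
  exists K, forall t, 1 <= t -> Cmod (gamma_integrand z 1 t) <= exp (K - t / 2).
Proof.
  (* From ln t <= ln c + t / c, the power of t costs at most a ln c + a t / c; this [c] makes a / c
     at most 1/2, so half of the exponential decay survives. *)
  set (a := Rabs (Re z - 1)). set (c := 2 * (a + 1)).
  assert (Ha : 0 <= a) by apply Rabs_pos.
  exists (a * ln c). intros t Ht. rewrite Cmod_gamma_integrand. apply exp_monotone.
  assert (Hl : 0 <= ln t) by (rewrite <- ln_1; apply ln_le; lra).
  assert (H1 : (Re z - 1) * ln t <= a * ln t)
    by (apply Rmult_le_compat_r; [exact Hl | apply Rle_abs]).
  assert (H2 : ln t <= ln c + t / c).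
  { replace t with (c * (t / c)) at 1 by (field; unfold c; lra).
    assert (Htc : 0 < t / c) by (apply Rdiv_lt_0_compat; unfold c; lra).
    rewrite ln_mult by (unfold c in *; lra).
    assert (H := exp_ineq1_le (ln (t / c))). rewrite exp_ln in H by exact Htc. lra. }
  assert (H3 : a * (t / c) <= t / 2).
  { unfold c. apply Rmult_le_reg_r with (2 * (a + 1)); [lra|].
    replace (a * (t / (2 * (a + 1))) * (2 * (a + 1))) with (a * t) by (field; lra). nra. }
  assert (H4 := Rmult_le_compat_l a _ _ Ha H2). lra.
Qed.

(** The factor 2 is that of the tail: exp (K - s / 2) integrated from t to infinity is 2 exp (K - t
    / 2). *)
Lemma exp_tail_small (K eps : R) : 0 < eps ->
  exists T, 1 <= T /\ forall t, T < t -> 2 * exp (K - t / 2) < eps.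
Proof.
  intros He. exists (Rmax 1 (2 * (K - ln (eps / 2)))). split; [apply Rmax_l|].
  intros t Ht. assert (H := Rle_lt_trans _ _ _ (Rmax_r _ _) Ht).
  replace eps with (2 * exp (ln (eps / 2))) by (rewrite exp_ln by lra; field).
  apply Rmult_lt_compat_l; [lra|]. apply exp_increasing. lra.
Qed.

Lemma filterlim_gamma_integrand_p_infty (z : C) :
  filterlim (gamma_integrand z 1) (Rbar_locally p_infty) (locally (RtoC 0)).
Proof.
  destruct (Cmod_gamma_integrand_le z) as [K HK].
  apply (filterlim_C_squeeze (Rbar_locally p_infty) _ (fun t => exp (K - t / 2))).
  - exists 1. intros t Ht. apply HK. lra.
  - apply filterlim_locally. intros eps.
    destruct (exp_tail_small K eps (cond_pos eps)) as [T [_ HT]].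
    exists T. intros t Ht. specialize (HT t Ht).
    unfold ball; simpl; unfold AbsRing_ball, minus, plus, opp, abs; simpl.
    assert (H := exp_pos (K - t / 2)). rewrite Rabs_pos_eq by lra. lra.
Qed.

Lemma gamma_primitive_tail (z : C) (K u v : R) : 0 < Re z -> 1 <= u <= v ->
  (forall t, 1 <= t -> Cmod (gamma_integrand z 1 t) <= exp (K - t / 2)) ->
  Cmod (gamma_primitive z 1 v - gamma_primitive z 1 u) <= 2 * exp (K - u / 2).
Proof.
  intros Hz Huv HK.
  assert (H : is_RInt (V := C_R_NormedModule) (gamma_integrand z 1) u v
                (gamma_primitive z 1 v - gamma_primitive z 1 u)%C).
  { apply (is_RInt_derive (V := C_R_CompleteNormedModule)
      (gamma_primitive z 1) (gamma_integrand z 1)); intros t Ht;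
      rewrite Rmin_left in Ht by lra.
    - apply is_derive_gamma_primitive; [exact Hz | lra].
    - apply continuous_gamma_integrand. lra. }
  assert (H' : is_RInt (fun t => exp (K - t / 2)) u v
                 (- 2 * exp (K - v / 2) - - 2 * exp (K - u / 2))).
  { apply (is_RInt_derive (fun t => - 2 * exp (K - t / 2))); intros t _.
    - auto_derive; [exact I|]. change (K + - (t * / 2)) with (K - t / 2). field.
    - apply (ex_derive_continuous (V := R_NormedModule)). auto_derive. exact I. }
  rewrite Cmod_norm. apply Rle_trans with (- 2 * exp (K - v / 2) - - 2 * exp (K - u / 2)).
  - apply (norm_RInt_le (V := C_R_NormedModule) (gamma_integrand z 1)
      (fun t => exp (K - t / 2)) u v); [lra | | exact H | exact H'].
    intros t Ht. rewrite <- Cmod_norm. apply HK. lra.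
  - assert (Hv := exp_pos (K - v / 2)). lra.
Qed.

(** The series bound on the primitive grows like exp t and says nothing at infinity, so the limit
    comes from the Cauchy criterion applied to integrals of the decaying integrand. *)
Lemma gamma_primitive_p_infty (z : C) : 0 < Re z ->
  exists l : C, filterlim (gamma_primitive z 1) (Rbar_locally p_infty) (locally l).
Proof.
  intros Hz. destruct (Cmod_gamma_integrand_le z) as [K HK].
  apply (filterlim_locally_cauchy (U := C_R_CompleteNormedModule)). intros eps.
  destruct (exp_tail_small K eps (cond_pos eps)) as [T [HT1 HT]].
  exists (fun t => T < t). split; [exists T; auto|]. intros u v Hu Hv.
  assert (Hball : forall u v, T < u -> u <= v ->
    ball (M := C_UniformSpace) (gamma_primitive z 1 u) eps (gamma_primitive z 1 v)).
  { intros u' v' Hu' Huv'. apply C_NormedModule_mixin_compat1.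
    apply Rle_lt_trans with (2 := HT u' Hu').
    apply gamma_primitive_tail; [exact Hz | lra | exact HK]. }
  destruct (Rle_dec u v) as [h|h].
  - apply Hball; assumption.
  - apply (ball_sym (M := C_UniformSpace)). apply Hball; [assumption | lra].
Qed.

Lemma is_RInt_gen_CGamma (z : C) : 0 < Re z ->
  is_RInt_gen (V := C_R_NormedModule) (gamma_integrand z 1)
    (at_right 0) (Rbar_locally p_infty) (CGamma z).
Proof.
  intros Hz. destruct (gamma_primitive_p_infty z Hz) as [l Hl].
  assert (H : is_RInt_gen (V := C_R_NormedModule) (gamma_integrand z 1)
    (at_right 0) (Rbar_locally p_infty) (l - 0)%C).
  { apply (is_RInt_gen_primitive (gamma_primitive z 1)).
    - apply Rbar_locally_filter.
    - intros t Ht. apply is_derive_gamma_primitive; assumption.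
    - intros t Ht. apply continuous_gamma_integrand, Ht.
    - exists 0. auto.
    - apply filterlim_gamma_primitive_0, Hz.
    - exact Hl. }
  replace (CGamma z) with (l - 0)%C; [exact H|].
  symmetry. apply (CRInt_gen_unique _ (at_right 0) (Rbar_locally p_infty)).
  apply (is_RInt_gen_ext (V := C_R_NormedModule)
    (Fa := at_right 0) (Fb := Rbar_locally p_infty) (gamma_integrand z 1)); [|exact H].
  apply (Filter_prod (at_right 0) (Rbar_locally p_infty) _ (fun a => 0 < a) (fun b => 0 < b)).
  - exists (mkposreal 1 Rlt_0_1). intros; assumption.
  - exists 0. auto.
  - intros a b Ha Hb t Ht. simpl in Ht.
    assert (Ht0 : 0 < t) by (apply Rlt_trans with (2 := proj1 Ht), Rmin_glb_lt; assumption).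
    unfold gamma_integrand, Cpower. rewrite Clog_pos by exact Ht0. f_equal. f_equal. ring.
Qed.

Lemma CGamma_plus_one (z : C) : 0 < Re z -> CGamma (z + 1) = (z * CGamma z)%C.
Proof.
  intros Hz.
  assert (Hz1 : 0 < Re (z + 1)) by (simpl; unfold Re in *; lra).
  assert (H1 := is_RInt_gen_minus (V := C_R_NormedModule) _ _ _ _
    (is_RInt_gen_Cmult _ _ z _ _ (is_RInt_gen_CGamma z Hz)) (is_RInt_gen_CGamma (z + 1) Hz1)).
  (* Integration by parts: [t^z e^(-t)] vanishes at both ends. *)
  assert (H2 : is_RInt_gen (V := C_R_NormedModule)
    (fun t => z * gamma_integrand z 1 t - gamma_integrand (z + 1) 1 t)%C
    (at_right 0) (Rbar_locally p_infty) (0 - 0)%C).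
  { apply (is_RInt_gen_primitive (gamma_integrand (z + 1) 1)).
    - apply Rbar_locally_filter.
    - intros t Ht.
      assert (H := is_derive_RC_mult _ _ _ _ _
        (is_derive_RC_Cexp (z + 1 - 1) ln t (/ t) (is_derive_ln t Ht))
        (is_derive_RC_Cexp (- (1)) (fun s => s) t 1 (is_derive_id t))).
      match type of H with is_derive _ _ ?l =>
        replace (z * gamma_integrand z 1 t - gamma_integrand (z + 1) 1 t)%C with (l : C);
          [exact H|] end.
      unfold gamma_integrand.
      replace (z + 1 - 1)%C with z by ring.
      rewrite <- (Cexp_minus_one_ln z t Ht), RtoC_inv by lra. field.
      intros h. apply (f_equal Re) in h. simpl in h. lra.
    - intros t Ht.
      destruct (is_derive_gamma_integrand z 1 t Ht) as [l1 Hl1].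
      destruct (is_derive_gamma_integrand (z + 1) 1 t Ht) as [l2 Hl2].
      apply (ex_derive_continuous (V := C_R_NormedModule)). eexists.
      exact (is_derive_minus (V := C_R_NormedModule) _ _ _ _ _
        (is_derive_RC_mult _ _ _ _ _ (is_derive_const (V := C_R_NormedModule) z t) Hl1) Hl2).
    - exists 0. auto.
    - apply (filterlim_C_squeeze (at_right 0) _ (fun t => exp (Re z * ln t))).
      + exists (mkposreal 1 Rlt_0_1). intros t _ Ht. rewrite Cmod_gamma_integrand.
        apply exp_monotone. simpl. unfold Re. nra.
      + apply filterlim_exp_ln_0, Hz.
    - apply filterlim_gamma_integrand_p_infty. }
  assert (E1 := CRInt_gen_unique _ _ _ _ H1). assert (E2 := CRInt_gen_unique _ _ _ _ H2).
  assert (E : (z * CGamma z - CGamma (z + 1))%C = (0 - 0)%C) by (rewrite <- E2; symmetry; exact E1).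
  replace (CGamma (z + 1)) with (z * CGamma z - (z * CGamma z - CGamma (z + 1)))%C by ring.
  rewrite E. ring.
Qed.

(** * Non-vanishing of the gamma function *)

(** 1 - cos th = 2 sin^2 (th / 2), and |sin w| <= |w|. *)
Lemma cos_ge_quadratic (th : R) : 1 - th ^ 2 / 2 <= cos th.
Proof.
  assert (H : Rsqr (sin (th / 2)) <= Rsqr (th / 2)).
  { set (u := th / 2). assert (Hu : forall w, 0 <= w -> Rsqr (sin w) <= Rsqr w).
    { intros w Hw.
      apply neg_pos_Rsqr_le.
      - destruct (Rle_dec w 1) as [h|h].
        + assert (H := sin_ge_0 w Hw). assert (H' := PI2_1). lra.
        + assert (H := SIN_bound w). lra.
      - destruct (Req_dec w 0) as [->|h]; [rewrite sin_0; lra|].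
        left. apply sin_lt_x. lra. }
    destruct (Rle_dec 0 u) as [h|h]; [now apply Hu|].
    rewrite (Rsqr_neg (sin u)), (Rsqr_neg u), <- sin_neg. apply Hu. lra. }
  replace th with (2 * (th / 2)) at 2 by field. rewrite cos_2a_sin. unfold Rsqr in H. lra.
Qed.

(** With u = exp (2 v) the claim is v^2 <= (exp v - exp (- v))^2, a consequence of 1 + v <= exp v.
    The right side is chosen because factors u and 1/u merely shift the parameter of a gamma
    integral by one. *)
Lemma ln_sqr_le (u : R) : 0 < u -> ln u ^ 2 <= 4 * (u - 2 + / u).
Proof.
  intros Hu. set (v := ln u / 2).
  assert (Eu : u = exp v * exp v)
    by (rewrite <- exp_plus; unfold v; replace (_ + _) with (ln u) by field; now rewrite exp_ln).
  assert (E1 : exp v * exp (- v) = 1) by (rewrite <- exp_plus, Rplus_opp_r; apply exp_0).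
  assert (Ei : / u = exp (- v) * exp (- v)).
  { rewrite Eu, Rinv_mult, exp_Ropp. reflexivity. }
  replace (ln u) with (2 * v) by (unfold v; field).
  rewrite Ei, Eu. assert (Hp := exp_ineq1_le v). assert (Hq := exp_ineq1_le (- v)).
  assert (Hp0 := exp_pos v). assert (Hq0 := exp_pos (- v)).
  set (p := exp v) in *. set (q := exp (- v)) in *.
  assert (Hpq : v ^ 2 <= (p - q) ^ 2).
  { destruct (Rle_dec 0 v); [assert (q <= 1) by nra | assert (p <= 1) by nra]; nra. }
  nra.
Qed.

(** Turns pointwise positivity into information on the improper integral; [1, 2] is just a fixed
    compact interval away from the singularity. *)
Lemma RInt_le_is_RInt_gen (h : R -> R) (l : R) :
  (forall t, 0 < t -> 0 <= h t) -> (forall t, 0 < t -> continuous h t) ->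
  is_RInt_gen h (at_right 0) (Rbar_locally p_infty) l -> RInt h 1 2 <= l.
Proof.
  intros Hpos Hcont H. apply Rnot_lt_le. intros Hl.
  destruct (H (fun y => y < RInt h 1 2) (open_lt _ _ Hl)) as [P Q HP HQ HPQ].
  destruct HP as [da Hda]. destruct HQ as [T HT].
  (* Endpoints accepted by both filters and enclosing [1, 2]. *)
  set (a := Rmin (da / 2) 1). set (b := Rmax (T + 1) 2).
  assert (Hda0 := cond_pos da).
  assert (Ha0 : 0 < a) by (apply Rmin_glb_lt; lra).
  assert (Ha1 : a <= 1) by apply Rmin_r. assert (Hb : 2 <= b) by apply Rmax_r.
  assert (Ha : P a).
  { apply Hda; [|exact Ha0]. assert (H0 := Rmin_l (da / 2) 1). fold a in H0.
    unfold ball; simpl; unfold AbsRing_ball, minus, plus, opp, abs; simpl.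
    rewrite Rabs_pos_eq; lra. }
  assert (HQb : Q b) by (apply HT; assert (H0 := Rmax_l (T + 1) 2); fold b in H0; lra).
  destruct (HPQ a b Ha HQb) as [y [Hy1 Hy2]]. simpl in Hy1.
  assert (Hex : forall c d, 0 < c -> c <= d -> ex_RInt h c d).
  { intros c d Hc Hcd. apply (ex_RInt_continuous (V := R_CompleteNormedModule)). intros t Ht.
    rewrite Rmin_left in Ht by exact Hcd. apply Hcont. lra. }
  apply (is_RInt_unique (V := R_CompleteNormedModule)) in Hy1.
  assert (E1 := RInt_Chasles h a 1 2 (Hex a 1 Ha0 Ha1) (Hex 1 2 ltac:(lra) ltac:(lra))).
  assert (E2 := RInt_Chasles h a 2 b (Hex a 2 Ha0 ltac:(lra)) (Hex 2 b ltac:(lra) Hb)).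
  assert (N1 : 0 <= RInt h a 1) by (apply RInt_ge_0; [lra | now apply Hex | intros; apply Hpos; lra]).
  assert (N2 : 0 <= RInt h 2 b)
    by (apply RInt_ge_0; [lra | apply Hex; lra | intros; apply Hpos; lra]).
  unfold plus in E1, E2; simpl in E1, E2. lra.
Qed.

Definition real_gamma_integrand (X t : R) : R := exp ((X - 1) * ln t - t).

Lemma gamma_integrand_polar (z : C) (t : R) :
  gamma_integrand z 1 t = (RtoC (real_gamma_integrand (Re z) t) * Cexp (0, (Im z * ln t)%R))%C.
Proof.
  unfold gamma_integrand, real_gamma_integrand. rewrite <- Cexp_RtoC, <- !Cexp_plus.
  f_equal. destruct z as [a b]. apply C_eq; simpl; ring.
Qed.

Lemma continuous_real_gamma_integrand (X t : R) : 0 < t ->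
  continuous (real_gamma_integrand X) t.
Proof.
  intros Ht. apply (ex_derive_continuous (V := R_NormedModule)).
  unfold real_gamma_integrand. auto_derive. exact Ht.
Qed.

Lemma is_RInt_gen_real_gamma (X : R) : 0 < X ->
  is_RInt_gen (real_gamma_integrand X) (at_right 0) (Rbar_locally p_infty)
    (Re (CGamma (RtoC X))).
Proof.
  intros HX.
  apply (is_RInt_gen_ext (Fa := at_right 0) (Fb := Rbar_locally p_infty)
    (fun t => Re (gamma_integrand (RtoC X) 1 t))).
  - apply filter_forall. intros ab t _. rewrite gamma_integrand_polar, re_scal_l.
    simpl. rewrite Rmult_0_l, exp_0, cos_0. ring.
  - apply is_RInt_gen_Re; try typeclasses eauto. apply is_RInt_gen_CGamma. exact HX.
Qed.

Lemma real_gamma_pos (X : R) : 0 < X -> 0 < Re (CGamma (RtoC X)).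
Proof.
  intros HX. apply Rlt_le_trans with (RInt (real_gamma_integrand X) 1 2).
  - apply RInt_gt_0; [lra | intros; apply exp_pos |].
    intros t Ht. apply continuous_real_gamma_integrand. lra.
  - apply RInt_le_is_RInt_gen.
    + intros t _. left; apply exp_pos.
    + apply continuous_real_gamma_integrand.
    + apply is_RInt_gen_real_gamma, HX.
Qed.

Lemma real_gamma_plus_one (X : R) : 0 < X ->
  Re (CGamma (RtoC (X + 1))) = X * Re (CGamma (RtoC X)).
Proof.
  intros HX. rewrite RtoC_plus, CGamma_plus_one by exact HX. apply re_scal_l.
Qed.

Lemma real_gamma_integrand_plus_one (X t : R) : 0 < t ->
  real_gamma_integrand (X + 1) t = t * real_gamma_integrand X t.
Proof.
  intros Ht. unfold real_gamma_integrand. rewrite <- (exp_ln t) at 3 by exact Ht.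
  rewrite <- exp_plus. f_equal. ring.
Qed.

(* For large real part the mass of [t^(X-1) e^(-t)] concentrates near [t = X], where
   the phase [t^(iy)] is nearly constant: after rotating by [X^(-iy)], the real part is
   bounded below through [cos (y ln u) >= 1 - 2 y^2 (u - 2 + 1/u)] with [u = t/X]. *)
Lemma CGamma_neq_0_large (z : C) : 1 < Re z -> 2 * Im z ^ 2 < Re z - 1 -> CGamma z <> 0%C.
Proof.
  intros HX Hy E0. destruct z as [X y]. simpl Re in *. simpl Im in *.
  assert (HL := is_RInt_gen_Re (at_right 0) (Rbar_locally p_infty) _ _
    (is_RInt_gen_Cmult (at_right 0) (Rbar_locally p_infty) (Cexp (0, (- y * ln X)%R)) _ _
      (is_RInt_gen_CGamma (X, y) ltac:(simpl; lra)))).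
  rewrite E0, Cmult_0_r in HL. simpl Re in HL.
  set (g := real_gamma_integrand) in *.
  set (G := Re (CGamma (RtoC X))).
  assert (HG : is_RInt_gen (g X) (at_right 0) (Rbar_locally p_infty) G)
    by (apply is_RInt_gen_real_gamma; lra).
  assert (HGp : is_RInt_gen (g (X + 1)) (at_right 0) (Rbar_locally p_infty) (X * G)).
  { unfold G. rewrite <- real_gamma_plus_one by lra. apply is_RInt_gen_real_gamma; lra. }
  assert (HGm : is_RInt_gen (g (X - 1)) (at_right 0) (Rbar_locally p_infty) (G / (X - 1))).
  { replace (G / (X - 1)) with (Re (CGamma (RtoC (X - 1)))).
    - apply is_RInt_gen_real_gamma; lra.
    - unfold G. replace (RtoC X) with (RtoC (X - 1 + 1)) by (f_equal; ring).
      rewrite real_gamma_plus_one by lra. field. lra. }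
  assert (HG0 : 0 < G) by (apply real_gamma_pos; lra).
  (* With u = t / X this is [g X t] times cos (y ln u) - 1 + 2 y^2 (u - 2 + 1/u), hence nonnegative.
     The factors u and 1/u are absorbed as [g (X + 1)] and [g (X - 1)], whose integrals are
     multiples of [G]. *)
  set (k := fun t => g X t * cos (y * (ln t - ln X)) + (- (1 + 4 * y ^ 2) * g X t
    + (2 * y ^ 2 / X * g (X + 1) t + 2 * y ^ 2 * X * g (X - 1) t))).
  assert (Hk : is_RInt_gen k (at_right 0) (Rbar_locally p_infty)
    (0 + (- (1 + 4 * y ^ 2) * G
      + (2 * y ^ 2 / X * (X * G) + 2 * y ^ 2 * X * (G / (X - 1)))))).
  { apply (is_RInt_gen_ext (Fa := at_right 0) (Fb := Rbar_locally p_infty)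
      (fun t => Re (Cexp (0, (- y * ln X)%R) * gamma_integrand (X, y) 1 t)
        + (- (1 + 4 * y ^ 2) * g X t
        + (2 * y ^ 2 / X * g (X + 1) t + 2 * y ^ 2 * X * g (X - 1) t)))).
    - apply filter_forall. intros ab t _. unfold k. f_equal.
      rewrite gamma_integrand_polar, Cmult_comm, <- Cmult_assoc, <- Cexp_plus, re_scal_l.
      f_equal. simpl. rewrite Rplus_0_r, exp_0, Rmult_1_l. f_equal. ring.
    - apply (is_RInt_gen_plus (V := R_NormedModule)); [exact HL|].
      apply (is_RInt_gen_plus (V := R_NormedModule));
        [exact (is_RInt_gen_scal (V := R_NormedModule) _ _ _ HG)|].
      apply (is_RInt_gen_plus (V := R_NormedModule)).
      + exact (is_RInt_gen_scal (V := R_NormedModule) _ _ _ HGp).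
      + exact (is_RInt_gen_scal (V := R_NormedModule) _ _ _ HGm). }
  assert (Hkpos : forall t, 0 < t -> 0 <= k t).
  { intros t Ht. unfold k.
    assert (E1 : g (X + 1) t = t * g X t) by (apply real_gamma_integrand_plus_one, Ht).
    assert (E2 : g (X - 1) t = g X t / t).
    { replace (g X t) with (g (X - 1 + 1) t) by (f_equal; ring).
      unfold g. rewrite real_gamma_integrand_plus_one by exact Ht. field. lra. }
    rewrite E1, E2. assert (Hg : 0 < g X t) by apply exp_pos.
    assert (Hc := cos_ge_quadratic (y * (ln t - ln X))).
    assert (Hu : 0 < t / X) by (apply Rdiv_lt_0_compat; lra).
    assert (Hl := ln_sqr_le (t / X) Hu). rewrite ln_div in Hl by lra.
    replace (/ (t / X)) with (X / t) in Hl by (field; lra).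
    replace (_ + _) with (g X t * (cos (y * (ln t - ln X))
      - 1 + 2 * y ^ 2 * (t / X - 2 + X / t))) by (field; lra).
    apply Rmult_le_pos; [lra|].
    assert (Hy2 := Rmult_le_compat_l (y ^ 2) _ _ (pow2_ge_0 y) Hl).
    rewrite Rpow_mult_distr in Hc. lra. }
  assert (Hkcont : forall t, 0 < t -> continuous k t).
  { intros t Ht. apply (ex_derive_continuous (V := R_NormedModule)).
    unfold k, g, real_gamma_integrand. auto_derive. repeat split; exact Ht. }
  assert (H1 := RInt_le_is_RInt_gen k _ Hkpos Hkcont Hk).
  assert (H2 : 0 <= RInt k 1 2).
  { apply RInt_ge_0; [lra | |intros; apply Hkpos; lra].
    apply (ex_RInt_continuous (V := R_CompleteNormedModule)). intros t Ht.
    rewrite Rmin_left in Ht by lra. apply Hkcont. lra. }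
  (* The cosine term contributes 0 since Gamma was assumed to vanish; what is left of the integral
     is negative by the hypothesis on the imaginary part. *)
  assert (H3 : 0 <= G * (2 * y ^ 2 / (X - 1) - 1)).
  { apply Rle_trans with (1 := H2). apply Rle_trans with (1 := H1). right. field. lra. }
  assert (H4 : 2 * y ^ 2 / (X - 1) < 1) by (apply Rlt_div_l; lra).
  nra.
Qed.

Lemma CGamma_neq_0 (z : C) : 0 < Re z -> CGamma z <> 0%C.
Proof.
  intros Hz E0.
  assert (H : forall n, CGamma (z + RtoC (INR n)) = 0%C).
  { induction n as [|n IH].
    - rewrite Cplus_0_r. exact E0.
    - rewrite S_INR, RtoC_plus, Cplus_assoc, CGamma_plus_one, IH; [ring|].
      simpl. assert (H := pos_INR n). unfold Re in *. lra. }
  (* Integer shifts keep the imaginary part, so the real part eventually exceeds 2 (Im z)^2 + 1. *)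
  destruct (INR_unbounded (2 * Im z ^ 2 + 1)) as [n Hn].
  assert (H0 := pow2_ge_0 (Im z)).
  apply (CGamma_neq_0_large (z + RtoC (INR n))); [| |apply H].
  - simpl. unfold Re, Im in *. lra.
  - replace (Im (z + RtoC (INR n))) with (Im z) by (simpl; unfold Im; ring).
    simpl Re. unfold Re, Im in *. lra.
Qed.

(** * Pochhammer symbols and the hypergeometric series *)

Lemma Cpochhammer_ratio (nu : C) (k : nat) : 0 < Re nu ->
  (Cpochhammer nu k / Cpochhammer (nu + 1) k)%C = (nu / (nu + RtoC (INR k)))%C.
Proof.
  intros Hnu. unfold Cpochhammer.
  assert (Hk : 0 < Re (nu + RtoC (INR k))).
  { simpl. assert (H := pos_INR k). unfold Re in *. lra. }
  replace (nu + 1 + RtoC (INR k))%C with (nu + RtoC (INR k) + 1)%C by ring.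
  rewrite !CGamma_plus_one by assumption.
  field. repeat split; try (apply CGamma_neq_0; assumption).
  - apply shift_neq_0, Hnu.
  - intros h. rewrite h in Hnu. simpl in Hnu. lra.
Qed.

Lemma Cpochhammer_neq_0 (nu : C) (k : nat) : 0 < Re nu -> Cpochhammer nu k <> 0%C.
Proof.
  intros Hnu. unfold Cpochhammer, Cdiv. apply Cmult_neq_0.
  - apply CGamma_neq_0. simpl. assert (H := pos_INR k). unfold Re in *. lra.
  - assert (H := CGamma_neq_0 nu Hnu). apply Cmod_gt_0. rewrite Cmod_inv by exact H.
    apply Rinv_0_lt_compat, Cmod_gt_0, H.
Qed.

(** [CSeries] selects its value by [iota], so convergence has to come first: it is shown for the
    simple terms by comparison with exp, then carried over to the Pochhammer form by the factor
    nu^2. *)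
Lemma is_series_hyp2F2 (nu z : C) : 0 < Re nu ->
  is_series (V := C_NormedModule)
    (fun k => (z ^ k / RtoC (INR (fact k)) / (nu + RtoC (INR k)) ^ 2)%C)
    (hyp2F2 nu nu (nu + 1) (nu + 1) z / nu ^ 2)%C.
Proof.
  intros Hnu.
  assert (Hnu0 : nu <> 0%C) by (intros h; rewrite h in Hnu; simpl in Hnu; lra).
  set (a := fun k => (z ^ k / RtoC (INR (fact k)) / (nu + RtoC (INR k)) ^ 2)%C).
  destruct (ex_Cseries_le a (fun k => / Re nu ^ 2 * (Cmod z ^ k / INR (fact k)))) as [D HD].
  - intros k. unfold a. rewrite Cmod_div by (apply Cpow_nz, shift_neq_0, Hnu).
    rewrite Cmod_exp_coeff, Cmod_pow, Rmult_comm. unfold Rdiv at 1.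
    apply Rmult_le_compat_l.
    + apply Rdiv_le_0_compat; [apply pow_le, Cmod_ge_0 | apply INR_fact_lt_0].
    + apply Rinv_le_contravar; [apply pow_lt, Hnu|].
      apply pow_incr. split; [lra | apply Cmod_shift_ge].
  - exists (/ Re nu ^ 2 * exp (Cmod z)).
    apply (is_series_scal_l (V := R_NormedModule)), is_series_exp.
  - replace (hyp2F2 nu nu (nu + 1) (nu + 1) z / nu ^ 2)%C with D; [exact HD|].
    replace (hyp2F2 nu nu (nu + 1) (nu + 1) z) with (nu ^ 2 * D)%C; [now field|].
    symmetry. apply CSeries_unique. generalize (is_Cseries_scal (nu ^ 2)%C _ _ HD).
    apply (is_series_ext (V := C_NormedModule)). intros k. unfold a.
    match goal with |- ?a = ?b => change (@eq C a b) end.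
    assert (H1 : 0 < Re (nu + 1)) by (simpl; unfold Re in *; lra).
    transitivity ((Cpochhammer nu k / Cpochhammer (nu + 1) k) ^ 2
      * (z ^ k / RtoC (INR (fact k))))%C.
    + rewrite Cpochhammer_ratio by exact Hnu. field.
      split; [apply RtoC_fact_neq_0 | apply shift_neq_0, Hnu].
    + field. split; [apply RtoC_fact_neq_0 | apply Cpochhammer_neq_0, H1].
Qed.

Theorem theorem30 (nu x : C) (hnu : 0 < Re nu) (hx : x <> 0%C) :
  is_derive
    (fun mu : C => lower_gamma mu x) nu
    (lower_gamma nu x * Clog x
     - Cpower x nu / nu ^ 2 * hyp2F2 nu nu (nu + 1) (nu + 1) (- x))%C.
Proof.
  replace (Cpower x nu / nu ^ 2 * hyp2F2 nu nu (nu + 1) (nu + 1) (- x))%C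
    with (Cpower x nu * (hyp2F2 nu nu (nu + 1) (nu + 1) (- x) / nu ^ 2))%C
    by (unfold Cdiv; ring).
  apply is_derive_lower_gamma; [exact hnu | exact hx |].
  apply is_series_hyp2F2, hnu.
Qed.
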